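(* Let $n$ and $k$ be positive integers with $k\leqslant n$, and let $K_n$ be the complete graph on $n$ vertices. Then $$\gamma_{k\text{-SRD}}(K_n)=\begin{cases}k+1, & \text{if } k<n,\\ n, & \text{if } k=n.\end{cases}$$
   Context: All graphs are finite, simple and undirected; $N(v)$ denotes the set of neighbors of $v$ and $\Delta(G)$ the maximum degree. Let $k\geqslant 1$ be an integer with $|V(G)|\geqslant k$. An attack pattern is a set $P\subseteq V(G)$ with $|P|=k$. A function $f:V(G)\to\{0,1,\ldots,\min(\Delta(G),k)+1\}$ is a proper $k$-SRD ($k$-strong Roman domination) function if for each attack pattern $P$ every vertex $u\in P$ with $f(u)=0$ can be defended by a neighboring vertex, where each vertex $v$ with $f(v)\geqslant 2$ can defend at most $f(v)-1$ of its neighbors in $P$ labeled 0 (and vertices with label $\leqslant 1$ defend no other vertex). That is, for each $P$ there is a map $\delta_P:\{u\in P : f(u)=0\}\to V(G)$ (which may depend on $P$) such that $\delta_P(u)\in N(u)$ and $f(\delta_P(u))\geqslant 2$ for all $u$ in its domain, and $|\delta_P^{-1}(v)|\leqslant f(v)-1$ for every $v$ with $f(v)\geqslant 2$. The weight is $\omega(f)=\sum_{v\in V(G)}f(v)$, and the $k$-SRD number is $\gamma_{k\text{-SRD}}(G)=\min\{\omega(f) : f \text{ is a proper } k\text{-SRD function on } G\}$. *)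

(* Defs.v *)
From HB Require Import structures.
From mathcomp Require Import all_boot.

Set Implicit Arguments.
Unset Strict Implicit.
Unset Printing Implicit Defensive.

Record sgraph := SGraph {
  vertex :> finType;
  adj : rel vertex;
  adj_sym : symmetric adj;
  adj_irrefl : irreflexive adj }.

Definition nbrs (G : sgraph) (v : G) : {set G} := [set w | adj v w].

Definition max_degree (G : sgraph) : nat := \max_(v : G) #|nbrs v|.

(* The values of a labelling are exactly 0, 1, ..., min(Delta(G), k) + 1. *)
Definition labelling (G : sgraph) (k : nat) : finType :=
  {ffun G -> 'I_(minn (max_degree G) k).+2}.

Definition attacked0 (G : sgraph) (k : nat) (f : labelling G k)
    (P : {set G}) : {set G} :=
  [set u in P | f u == 0 :> nat].

(* The defence map is a total function on the vertices, of which only the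
   restriction to [attacked0 f P] is ever constrained or counted. *)
Definition defends (G : sgraph) (k : nat) (f : labelling G k)
    (P : {set G}) (d : {ffun G -> G}) : bool :=
  [forall u in attacked0 f P, (d u \in nbrs u) && (2 <= f (d u))] &&
  [forall v : G,
     (2 <= f v) ==> (#|[set u in attacked0 f P | d u == v]| <= f v - 1)].

Definition proper_SRD (G : sgraph) (k : nat) (f : labelling G k) : bool :=
  [forall P : {set G},
     (#|P| == k) ==> [exists d : {ffun G -> G}, defends f P d]].

Definition weight (G : sgraph) (k : nat) (f : labelling G k) : nat :=
  \sum_(v : G) f v.

Lemma ex_proper_SRD (G : sgraph) (k : nat) :
  exists m, [exists f : labelling G k, proper_SRD f && (weight f == m)].
Proof.
pose f : labelling G k := [ffun=> inord 1].
have f1 v : f v = 1 :> nat by rewrite ffunE inordK.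
exists (weight f); apply/existsP; exists f; rewrite eqxx andbT.
apply/forallP=> P; apply/implyP=> _; apply/existsP.
exists [ffun u => u]; apply/andP; split.
  by apply/forallP=> u; rewrite inE f1 andbF.
by apply/forallP=> v; rewrite f1.
Qed.

Definition SRD_number (G : sgraph) (k : nat) : nat := ex_minn (ex_proper_SRD G k).

Definition complete_rel (n : nat) : rel 'I_n := fun x y => x != y.

Lemma complete_sym n : symmetric (@complete_rel n).
Proof. by move=> x y; rewrite /complete_rel eq_sym. Qed.

Lemma complete_irrefl n : irreflexive (@complete_rel n).
Proof. by move=> x; rewrite /complete_rel eqxx. Qed.

Definition complete_graph (n : nat) : sgraph :=
  SGraph (@complete_sym n) (@complete_irrefl n).

(* Main.v *)
Require Import Defs.
From mathcomp Require Import all_boot.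
From mathcomp Require Import zify.

(* Since 0.-1 = 0, splitting every label as f v = (f v).-1 + (0 < f v) turns the
   total defence capacity into weight f minus the number of nonzero labels.
   Attacking as many zero labels as possible then bounds the weight from
   below. *)

(** Supplies attack patterns of size exactly [k] that contain, or lie inside, a prescribed set. They
    grow from [A] by adding one point of [B] at a time. *)
Lemma exists_set_between (T : finType) (A B : {set T}) (k : nat) :
  A \subset B -> #|A| <= k <= #|B| ->
  exists P : {set T}, [/\ A \subset P, P \subset B & #|P| = k].
Proof.
move=> sAB /andP[+ leB].
elim: k leB => [|k IHk] leB leA.
  by exists A; split=> //; apply/eqP; rewrite -leqn0.
move: leA; rewrite leq_eqVlt ltnS => /orP[/eqP eqA|leA]; first by exists A.
have [P [sAP sPB cardP]] := IHk (ltnW leB) leA.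
have : P \proper B by rewrite properEcard sPB cardP.
case/properP=> _ [x xB xP]; exists (x |: P); split.
- exact: subset_trans sAP (subsetUr _ _).
- by rewrite subUset sub1set xB.
- by rewrite cardsU1 xP cardP.
Qed.

Lemma weight_split (G : sgraph) (k : nat) (f : labelling G k) :
  weight f = \sum_(v : G) (f v).-1 + #|[set v | f v != 0 :> nat]|.
Proof.
rewrite -sum1dep_card [X in _ + X]big_mkcond -big_split; apply: eq_bigr => v _ /=.
by case: (nat_of_ord (f v)) => //= m; rewrite addn1.
Qed.

(** The attacked zeros are partitioned by their defender [d u], and each fibre is bounded by the
    capacity of that defender. *)
Lemma defends_card_le (G : sgraph) (k : nat) (f : labelling G k) (P : {set G})
    (d : {ffun G -> G}) :
  defends f P d -> #|attacked0 f P| <= \sum_(v : G) (f v).-1.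
Proof.
case/andP=> /forall_inP dN /forallP dC.
rewrite -sum1_card (partition_big d predT) //=; apply: leq_sum => v _.
have [f2|f1] := leqP 2 (f v).
  move: (dC v); rewrite f2 subn1 => /=; apply: leq_trans.
  by rewrite -sum1_card leq_eqVlt; apply/orP; left; apply/eqP/eq_bigl=> u; rewrite inE.
(* A vertex labelled 0 or 1 defends nobody, so its fibre is empty. *)
rewrite big_pred0 // => u; apply/negbTE/negP => /andP[/dN /andP[_ f2] /eqP duv].
by move: f1; rewrite ltnNge -duv f2.
Qed.

Lemma proper_SRD_weight_ge (G : sgraph) (k : nat) (f : labelling G k) :
  k <= #|G| -> proper_SRD f ->
  minn #|[set v | f v == 0 :> nat]| k + #|[set v | f v != 0 :> nat]| <= weight f.
Proof.
move=> lekG /forallP fP; set Z := [set v | f v == 0 :> nat].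
(* The worst attack: [P] contains all of [Z] if [Z] has at most [k] points, and otherwise lies
   inside [Z]. *)
have [P cardP sP] : exists2 P : {set G}, #|P| = k & minn #|Z| k <= #|P :&: Z|.
  have [leZ|/ltnW leZ] := leqP #|Z| k.
    have [||P [sZP _ cardP]] := @exists_set_between _ Z setT k.
    - exact: subsetT.
    - by rewrite leZ cardsT.
    by exists P; rewrite // (setIidPr sZP).
  have [||P [_ sPZ cardP]] := @exists_set_between _ set0 Z k.
  - exact: sub0set.
  - by rewrite cards0.
  by exists P; rewrite // (setIidPl sPZ) cardP.
move: (fP P); rewrite cardP eqxx => /existsP[d /(defends_card_le _ _ _ _ _) fd].
rewrite weight_split leq_add2r (leq_trans sP) // (leq_trans _ fd) //.
by apply/subset_leq_card/subsetP=> u; rewrite !inE.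
Qed.

Lemma SRD_number_eq (G : sgraph) (k m : nat) (f : labelling G k) :
  proper_SRD f -> weight f = m ->
  (forall g : labelling G k, proper_SRD g -> m <= weight g) ->
  SRD_number G k = m.
Proof.
move=> fP fm minm; rewrite /SRD_number; case: ex_minnP => w.
case/existsP=> g /andP[/minm + /eqP gw] minw; rewrite gw => lemw.
apply/eqP; rewrite eqn_leq lemw andbT; apply: minw.
by apply/existsP; exists f; rewrite fP fm eqxx.
Qed.

(** Needed to see that for [k < n] the largest permitted label on the complete graph is [k.+1]. *)
Lemma max_degree_complete (n : nat) :
  0 < n -> max_degree (complete_graph n) = n.-1.
Proof.
have degE (v : complete_graph n) : #|nbrs v| = n.-1.
  have -> : nbrs v = [set~ v].
    by apply/setP=> w; rewrite !inE /= /complete_rel eq_sym.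
  by rewrite cardsC1 card_ord.
move=> n_gt0; rewrite /max_degree (eq_bigr (fun=> n.-1)) => [|v _]; last exact: degE.
by rewrite (bigD1 (Ordinal n_gt0 : complete_graph n)) //=; apply/maxn_idPl/bigmax_leqP.
Qed.

Theorem lemma3 (n k : nat) (n_gt0 : 0 < n) (k_gt0 : 0 < k) (le_kn : k <= n) :
  SRD_number (complete_graph n) k = if k < n then k + 1 else n.
Proof.
have cardG : #|complete_graph n| = n by rewrite card_ord.
have lower (f : labelling (complete_graph n) k) : proper_SRD f ->
    (if k < n then k + 1 else n) <= weight f.
  move=> fP; have := proper_SRD_weight_ge _ _ f; rewrite cardG => /(_ le_kn fP).
  have := cardsC [set v | f v == 0 :> nat]; rewrite cardG.
  have -> : ~: [set v | f v == 0 :> nat] = [set v | f v != 0 :> nat].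
    by apply/setP=> v; rewrite !inE.
  (* Let z and c count the zero and nonzero labels, so z + c = n. If c is positive, [minn z k + c]
     suffices: it is n when z is at most k, and at least k + 1 otherwise. *)
  have [/cards0_eq nz0|nz] := eqVneq #|[set v | f v != 0 :> nat]| 0; last first.
    by move=> *; case: ltnP; lia.
  rewrite nz0 cards0 addn0 => zn.
  (* The zero labelling has weight 0, whereas the bound would force weight at least [k], which is
     positive. *)
  suff -> : weight f = 0 by rewrite zn; lia.
  apply: big1 => v _; apply/eqP; apply: contraFT (in_set0 v) => fv.
  by rewrite -nz0 inE.
case: ltnP lower => [lt_kn|le_nk] lower.
  pose v0 : complete_graph n := Ordinal n_gt0.
  pose f : labelling (complete_graph n) k :=
    (* A single vertex carries all the weight: it is adjacent to every other vertex and its capacity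
       [k] covers a whole attack. *)
    [ffun v => inord (if v == v0 then k.+1 else 0)].
  have fE v : f v = (if v == v0 then k.+1 else 0) :> nat.
    rewrite ffunE inordK // max_degree_complete //; case: ifP => // _; lia.
  apply: (SRD_number_eq _ _ _ f) => //; last first.
    rewrite /weight (bigD1 v0) //= fE eqxx big1 ?addn0 ?addn1 // => v vv0.
    by rewrite fE (negbTE vv0).
  apply/forallP=> P; apply/implyP=> /eqP cardP; apply/existsP.
  exists [ffun=> v0]; apply/andP; split.
    apply/forall_inP=> u; rewrite inE fE => /andP[_].
    case: (eqVneq u v0) => // uv0 _.
    by rewrite (ffunE (fun=> v0)) fE eqxx ltnS k_gt0 andbT inE.
  apply/forallP=> v; rewrite fE; case: (v == v0) => //.
  apply/implyP=> _; rewrite subn1 /= -[leqRHS]cardP.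
  by apply/subset_leq_card/subsetP=> u; rewrite !inE => /andP[/andP[]].
(* Here [k = n]. With every label 1 no zero is ever attacked, so any defence map works; the identity
   is chosen. *)
pose f : labelling (complete_graph n) k := [ffun=> inord 1].
have fE v : f v = 1 :> nat by rewrite ffunE inordK.
apply: (SRD_number_eq _ _ _ f) => //; last first.
  by rewrite /weight (eq_bigr (fun=> 1)) ?sum1_card.
apply/forallP=> P; apply/implyP=> _; apply/existsP; exists [ffun u => u].
apply/andP; split; last by apply/forallP=> v; rewrite fE.
by apply/forall_inP=> u; rewrite inE fE andbF.
Qed.
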